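(* The pointed set $K^2(C_3,C_6)$ has exactly three elements. In particular, any bicrossed product $C_3\bowtie C_6$ is isomorphic, by an isomorphism that fixes the group $C_3=\langle a\rangle$, to one of the following three groups: $$C_3\times C_6,\qquad \langle a,b\mid a^3=1,\ b^6=1,\ ba=a^2b\rangle,\qquad \langle a,b\mid a^3=1,\ b^6=1,\ ba=a^2b^3\rangle .$$
   Context: $C_n$ is the cyclic group of order $n$; $a$ denotes a generator of $C_3$ (embedded in $C_3\times C_6$ as the first factor and in the two presented groups via the generator $a$). A matched pair of groups $(H,G,\alpha,\beta)$ consists of groups $H$, $G$, a left action $\alpha:G\times H\to H$, $\alpha(g,h)=g\rhd h$, of the group $G$ on the set $H$, and a right action $\beta:G\times H\to G$, $\beta(g,h)=g\lhd h$, of the group $H$ on the set $G$, such that for all $g,g_1,g_2\in G$, $h,h_1,h_2\in H$: $g\rhd(h_1h_2)=(g\rhd h_1)\bigl((g\lhd h_1)\rhd h_2\bigr)$ and $(g_1g_2)\lhd h=\bigl(g_1\lhd(g_2\rhd h)\bigr)(g_2\lhd h)$. The bicrossed product $H\bowtie G=H\,{}_{\alpha}\!\bowtie_{\beta}G$ is the group on the set $H\times G$ with unit $(1_H,1_G)$ and multiplication $(h_1,g_1)(h_2,g_2)=\bigl(h_1(g_1\rhd h_2),\,(g_1\lhd h_2)g_2\bigr)$; $H$ is embedded in it by $h\mapsto(h,1)$. $MP(H,G)$ is the set of all pairs $(\alpha,\beta)$ such that $(H,G,\alpha,\beta)$ is a matched pair. For $(\alpha,\beta),(\alpha',\beta')\in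 MP(H,G)$ (with $\alpha,\beta$ written $\rhd,\lhd$ and $\alpha',\beta'$ written $\rhd',\lhd'$), $(\alpha,\beta)\approx_1(\alpha',\beta')$ means there exist maps $r:G\to H$ and $v:G\to G$ with $v$ bijective such that for all $h\in H$, $g,g_1,g_2\in G$: $(g\rhd'h)\,r(g\lhd'h)=r(g)(v(g)\rhd h)$; $v(g\lhd'h)=v(g)\lhd h$; $r(g_1g_2)=r(g_1)\bigl(v(g_1)\rhd r(g_2)\bigr)$; $v(g_1g_2)=\bigl(v(g_1)\lhd r(g_2)\bigr)v(g_2)$. This is an equivalence relation, and $K^2(H,G):=MP(H,G)/\!\approx_1$, pointed by the class of the pair of trivial actions. *)

(* Defs.v *)
From HB Require Import structures.
From mathcomp Require Import all_boot all_fingroup all_solvable.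
From mathcomp Require Import generic_quotient.
From mathcomp Require Import boolp classical_sets.

Set Implicit Arguments.
Unset Strict Implicit.
Unset Printing Implicit Defensive.

Local Open Scope group_scope.
Local Open Scope quotient_scope.

(* [lact g h] is g |> h and [ract g h] is g <| h.                             *)
Record is_matched_pair (H G : finGroupType)
    (lact : G -> H -> H) (ract : G -> H -> G) : Prop := IsMatchedPair {
  lact1 : forall h, lact 1 h = h;
  lactM : forall g1 g2 h, lact (g1 * g2) h = lact g1 (lact g2 h);
  ract1 : forall g, ract g 1 = g;
  ractM : forall g h1 h2, ract g (h1 * h2) = ract (ract g h1) h2;
  lact_mul : forall g h1 h2, lact g (h1 * h2) = lact g h1 * lact (ract g h1) h2;
  ract_mul : forall g1 g2 h, ract (g1 * g2) h = ract g1 (lact g2 h) * ract g2 h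
}.

Definition matched_pair (H G : finGroupType) : Type :=
  {p : {ffun G * H -> H} * {ffun G * H -> G} |
    `[< is_matched_pair (fun g h => p.1 (g, h)) (fun g h => p.2 (g, h)) >]}.
HB.instance Definition _ H G := Finite.on (matched_pair H G).

Definition mp_lact H G (m : matched_pair H G) (g : G) (h : H) : H :=
  (val m).1 (g, h).
Definition mp_ract H G (m : matched_pair H G) (g : G) (h : H) : G :=
  (val m).2 (g, h).

Lemma mpP H G (m : matched_pair H G) :
  is_matched_pair (mp_lact m) (mp_ract m).
Proof. exact/asboolP/(valP m). Qed.

Lemma mp_lactg1 H G (m : matched_pair H G) g : mp_lact m g 1 = 1.
Proof.
have := lact_mul (mpP m) g 1 1; rewrite mulg1 (ract1 (mpP m)).
by move=> e; apply: (mulgI (mp_lact m g 1)); rewrite mulg1.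
Qed.

Lemma mp_ract1g H G (m : matched_pair H G) h : mp_ract m 1 h = 1.
Proof.
have := ract_mul (mpP m) 1 1 h; rewrite mulg1 (lact1 (mpP m)).
by move=> e; apply: (mulgI (mp_ract m 1 h)); rewrite mulg1.
Qed.

Section TrivialPair.
Variables H G : finGroupType.

Let triv : {ffun G * H -> H} * {ffun G * H -> G} :=
  ([ffun x => x.2], [ffun x => x.1]).

Lemma triv_matched_pair :
  `[< is_matched_pair (fun g h => triv.1 (g, h)) (fun g h => triv.2 (g, h)) >].
Proof. by apply/asboolP; split=> *; rewrite !ffunE. Qed.

Definition trivial_mp : matched_pair H G := exist _ triv triv_matched_pair.

End TrivialPair.


Definition bicrossed H G (m : matched_pair H G) : Type := (H * G)%type.

Section Bicrossed.
Variables (H G : finGroupType) (m : matched_pair H G).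
Local Notation B := (bicrossed m).

Definition bicrossed_one : B := (1, 1).
Definition bicrossed_mul (x y : B) : B :=
  (x.1 * mp_lact m x.2 y.1, mp_ract m x.2 y.1 * y.2).
Definition bicrossed_inv (x : B) : B :=
  (mp_lact m x.2^-1 x.1^-1, mp_ract m x.2^-1 x.1^-1).

Lemma bicrossed_mulA : associative bicrossed_mul.
Proof.
case=> [h1 g1] [h2 g2] [h3 g3]; rewrite /bicrossed_mul /=; have M := mpP m.
by rewrite (lact_mul M) (ractM M) (ract_mul M) (lactM M) !mulgA.
Qed.

Lemma bicrossed_mul1 : left_id bicrossed_one bicrossed_mul.
Proof.
case=> [h g]; rewrite /bicrossed_mul /= (lact1 (mpP m)) mp_ract1g.
by rewrite !mul1g.
Qed.

Lemma bicrossed_mulV : left_inverse bicrossed_one bicrossed_inv bicrossed_mul.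
Proof.
case=> [h g]; rewrite /bicrossed_mul /bicrossed_inv /=; have M := mpP m.
by rewrite -(lact_mul M) -(ractM M) mulVg mp_lactg1 (ract1 M) mulVg.
Qed.

HB.instance Definition _ := Finite.on B.
HB.instance Definition _ := Finite_isGroup.Build B
  bicrossed_mulA bicrossed_mul1 bicrossed_mulV.

Definition bicrossed_inl (h : H) : B := (h, 1).

End Bicrossed.


Definition approx1 H G (m m' : matched_pair H G) : Prop :=
  exists (r : G -> H) (v : G -> G), [/\ bijective v,
    forall g h, mp_lact m' g h * r (mp_ract m' g h) = r g * mp_lact m (v g) h,
    forall g h, v (mp_ract m' g h) = mp_ract m (v g) h,
    forall g1 g2, r (g1 * g2) = r g1 * mp_lact m (v g1) (r g2) &
    forall g1 g2, v (g1 * g2) = mp_ract m (v g1) (r g2) * v g2].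

Section K2.
Variables H G : finGroupType.

Lemma approx1_refl (m : matched_pair H G) : approx1 m m.
Proof.
exists (fun=> 1), id; split=> [|g h|//|g1 g2|g1 g2].
- by exists id.
- by rewrite mulg1 mul1g.
- by rewrite mp_lactg1 mulg1.
- by rewrite (ract1 (mpP m)).
Qed.

Lemma approx1_sym (m m' : matched_pair H G) : approx1 m m' -> approx1 m' m.
Proof.
case=> r [v [[w vK wK] e1 e2 e3 e4]]; have M := mpP m; have M' := mpP m'.
have E1 g h : mp_lact m g h * (r (w (mp_ract m g h)))^-1
              = (r (w g))^-1 * mp_lact m' (w g) h.
  have := e1 (w g) h; rewrite wK => e.
  rewrite -[mp_ract m g h](congr1 (mp_ract m ^~ h) (wK g)) -e2 vK.
  by apply: (mulgI (r (w g))); rewrite mulgA -e mulgK mulKVg.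
have E2 g h : w (mp_ract m g h) = mp_ract m' (w g) h.
  by rewrite -{1}[g]wK -e2 vK.
have key g1 g2 : g1 * g2 = v (mp_ract m' (w g1) (r (w g2))^-1 * w g2).
  by rewrite e4 e2 wK -(ractM M) mulVg (ract1 M) wK.
exists (fun g => (r (w g))^-1), w; split=> [|//|//|g1 g2|g1 g2].
- by exists v.
- rewrite key vK e3 e2 wK; apply: (mulgI (r (w g1))).
  rewrite mulKVg; set a := r (w g1); set k := (r (w g2))^-1.
  have E := e1 (w g1) k; rewrite wK -/a in E.
  have L : r (mp_ract m' (w g1) k) = (mp_lact m' (w g1) k)^-1 * (a * mp_lact m g1 k).
    by rewrite -E mulKg.
  rewrite L -mulgA -mulgA -(lact_mul M) /k mulVg mp_lactg1 mulg1.
  by rewrite invMg invgK mulKVg.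
- by rewrite key vK.
Qed.

Lemma approx1_trans (m1 m2 m3 : matched_pair H G) :
  approx1 m1 m2 -> approx1 m2 m3 -> approx1 m1 m3.
Proof.
case=> r [v [bv e1 e2 e3 e4]] [s [w [bw f1 f2 f3 f4]]]; have M := mpP m1.
exists (fun g => s g * r (w g)), (v \o w); split=> [|g h|g h|g1 g2|g1 g2] /=.
- exact: bij_comp.
- by rewrite mulgA f1 f2 -!mulgA e1.
- by rewrite f2 e2.
- rewrite f3 f4 e3 e2 -mulgA (mulgA (mp_lact m2 _ _)) e1.
  by rewrite (lact_mul M) !mulgA.
- by rewrite f4 e4 e2 (ractM M).
Qed.

Definition approx1b : rel (matched_pair H G) :=
  fun m m' => `[< approx1 m m' >].

Lemma approx1b_equiv : equiv_class_of approx1b.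
Proof.
split=> [m|m m'|m2 m1 m3].
- exact/asboolP/approx1_refl.
- by apply/asboolP/asboolP; apply: approx1_sym.
- by move=> /asboolP h1 /asboolP h2; apply/asboolP/(approx1_trans h1 h2).
Qed.

Canonical approx1_equivRel := EquivRelPack approx1b_equiv.

Definition K2 : Type := {eq_quot approx1b}.
HB.instance Definition _ := EqQuotient.on K2.
HB.instance Definition _ := Choice.on K2.
HB.instance Definition _ : isCountable K2 := CanIsCountable (@reprK _ K2).
HB.instance Definition _ : isFinite K2 := CanIsFinite (@reprK _ K2).
HB.instance Definition _ := isPointed.Build K2 (\pi_K2 (trivial_mp H G)).

End K2.


(* A letter [(x, e)] denotes the generator x if e = false and its inverse if  *)
(* e = true; a relation [(u, w)] reads u = w.                                 *)
Definition word (T : Type) : Type := seq (T * bool).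
HB.instance Definition _ (T : choiceType) := Choice.on (word T).

Definition letter_inv T (x : T * bool) : T * bool := (x.1, ~~ x.2).
Definition word_inv T (w : word T) : word T := rev (map (@letter_inv T) w).

Inductive word_eq (T : Type) (rels : word T * word T -> Prop) :
    word T -> word T -> Prop :=
| WordEqRel u w : rels (u, w) -> word_eq rels u w
| WordEqCancel x : word_eq rels [:: x; letter_inv x] [::]
| WordEqRefl u : word_eq rels u u
| WordEqSym u w : word_eq rels u w -> word_eq rels w u
| WordEqTrans u w t : word_eq rels u w -> word_eq rels w t -> word_eq rels u t
| WordEqCat u u' w w' : word_eq rels u u' -> word_eq rels w w' ->
    word_eq rels (u ++ w) (u' ++ w').

Section Presentation.
Variables (T : choiceType) (rels : word T * word T -> Prop).

Lemma letter_invK : involutive (@letter_inv T).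
Proof. by case=> x b; rewrite /letter_inv /= negbK. Qed.

Lemma word_invK : involutive (@word_inv T).
Proof.
by move=> w; rewrite /word_inv map_rev revK -map_comp map_id_in // => x _ /=;
   rewrite letter_invK.
Qed.

Lemma word_inv_cat u w : word_inv (u ++ w) = word_inv w ++ word_inv u :> word T.
Proof. by rewrite /word_inv map_cat rev_cat. Qed.

Lemma word_mulV (w : word T) : word_eq rels (w ++ word_inv w) [::].
Proof.
elim: w => [|x w IH]; first exact: WordEqRefl.
rewrite -cat1s word_inv_cat -catA (catA w).
apply: WordEqTrans (WordEqCancel rels x).
apply: (@WordEqCat _ _ [:: x] [:: x] _ [:: letter_inv x]).
  exact: WordEqRefl.
exact: (WordEqCat IH (WordEqRefl _ _)).
Qed.

Lemma word_mulVg (w : word T) : word_eq rels (word_inv w ++ w) [::].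
Proof. by rewrite -{2}[w]word_invK; exact: word_mulV. Qed.

Lemma word_eq_inv (u w : word T) :
  word_eq rels u w -> word_eq rels (word_inv u) (word_inv w).
Proof.
move=> e; have R := WordEqRefl rels.
apply: (@WordEqTrans _ _ _ (word_inv u ++ (w ++ word_inv w))).
  rewrite -{1}[word_inv u]cats0; apply: WordEqCat (R _) _.
  exact/WordEqSym/word_mulV.
rewrite catA -{2}[word_inv w]cat0s; apply: WordEqCat (R _).
apply: WordEqTrans (word_mulVg u); apply: WordEqCat (R _) _.
exact: WordEqSym.
Qed.

Definition word_eqb : rel (word T) := fun u w => `[< word_eq rels u w >].

Lemma word_eqb_equiv : equiv_class_of word_eqb.
Proof.
split=> [u|u w|w u t].
- exact/asboolP/WordEqRefl.
- by apply/asboolP/asboolP; apply: WordEqSym.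
- by move=> /asboolP h1 /asboolP h2; apply/asboolP/(WordEqTrans h1 h2).
Qed.

Canonical word_equivRel := EquivRelPack word_eqb_equiv.

Definition presented : Type := {eq_quot word_eqb}.
HB.instance Definition _ := EqQuotient.on presented.
HB.instance Definition _ := Choice.on presented.

Lemma presentedP (u w : word T) :
  reflect (word_eq rels u w) (\pi_presented u == \pi_presented w).
Proof. by rewrite eqmodE; exact: asboolP. Qed.

Lemma presented_repr (u : word T) :
  word_eq rels (repr (\pi_presented u)) u.
Proof. by apply/presentedP; rewrite reprK. Qed.

Definition presented_one : presented := \pi_presented [::].
Definition presented_mul (x y : presented) : presented :=
  \pi_presented (repr x ++ repr y).
Definition presented_inv (x : presented) : presented :=
  \pi_presented (word_inv (repr x)).

Lemma presented_mulE (u w : word T) :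
  presented_mul (\pi_presented u) (\pi_presented w) = \pi_presented (u ++ w).
Proof. by apply/eqP/presentedP/WordEqCat; apply: presented_repr. Qed.

Lemma presented_invE (u : word T) :
  presented_inv (\pi_presented u) = \pi_presented (word_inv u).
Proof. by apply/eqP/presentedP/word_eq_inv/presented_repr. Qed.

Lemma presented_mulA : associative presented_mul.
Proof.
elim/quotW=> u; elim/quotW=> w; elim/quotW=> t.
by rewrite (presented_mulE w t) (presented_mulE u w) !presented_mulE catA.
Qed.

Lemma presented_mul1 : left_id presented_one presented_mul.
Proof. by move=> x; rewrite -[x]reprK /presented_one presented_mulE. Qed.

Lemma presented_mulr1 : right_id presented_one presented_mul.
Proof. by move=> x; rewrite -[x]reprK /presented_one presented_mulE cats0. Qed.

Lemma presented_mulV : left_inverse presented_one presented_inv presented_mul.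
Proof.
move=> x; rewrite -[x]reprK presented_invE presented_mulE.
exact/eqP/presentedP/word_mulVg.
Qed.

Lemma presented_mulgV : right_inverse presented_one presented_inv presented_mul.
Proof.
move=> x; rewrite -[x]reprK presented_invE presented_mulE.
exact/eqP/presentedP/word_mulV.
Qed.

HB.instance Definition _ := isGroup.Build presented
  presented_mulA presented_mul1 presented_mulr1 presented_mulV presented_mulgV.

Definition presented_gen (x : T) : presented := \pi_presented [:: (x, false)].

End Presentation.

(* Presentations on two generators, a = true and b = false.                   *)
Definition wa : word bool := [:: (true, false)].
Definition wb : word bool := [:: (false, false)].
Definition wpow (w : word bool) (n : nat) : word bool := flatten (nseq n w).

(* < a, b | a^3 = 1, b^6 = 1, ba = a^2 b^k >; only k = 1 and k = 3 are used.   *)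
Definition rels_C3C6 (k : nat) : word bool * word bool -> Prop :=
  fun p => [\/ p = (wpow wa 3, [::]), p = (wpow wb 6, [::]) |
               p = (wb ++ wa, wpow wa 2 ++ wpow wb k)].

Definition P_C3C6 (k : nat) : groupType := presented (rels_C3C6 k).
Definition Pa (k : nat) : P_C3C6 k := presented_gen (rels_C3C6 k) true.

(* An isomorphism B -> P carrying x to y; it then identifies <x> with <y>     *)
(* power by power.                                                            *)
Definition iso_fixing (B P : groupType) (x : B) (y : P) : Prop :=
  exists f : {multiplicative B -> P},
    bijective f /\ forall n : nat, f (x ^+ n) = y ^+ n.

(* Main.v *)
Require Import Defs.
From HB Require Import structures.
From mathcomp Require Import all_boot all_fingroup all_solvable.
From mathcomp Require Import generic_quotient.
From mathcomp Require Import boolp.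

Local Open Scope group_scope.

(** In a matched pair on C3 and C6 every element of C6 acts on the set C3
    fixing 1, hence as the identity or as inversion. The elements acting as the
    identity form a subgroup that the right action preserves, and on which this
    right action is by homomorphisms. Since C3 has exponent three and the
    automorphisms of a cyclic group of order 3 or 6 have order at most two,
    the right action fixes that subgroup pointwise ([ract_fix]).

    Let [b] be a generator of C6. If [b] acts as the identity, the pair is
    trivial. Otherwise the subgroup above consists of the even elements, those
    killed by cubing, and the pair is determined by the homomorphism
    [phi : C3 -> C6], [phi h = b^-1 (b <| h)]: an odd [g] inverts C3 and
    [g <| h = g * phi h] ([inverting_pair], [matched_pair_classification]).
    Conversely each homomorphism yields a pair ([inverting_pair_exists]). There
    are three of them, and inversion of C6 identifies the two nontrivial ones
    ([inverting_pair_approx1]). The resulting three classes are distinct: the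
    class of the trivial pair is a singleton, and triviality of the right
    action is an invariant, which holds exactly when [phi] is trivial.

    For the groups, choose [b] with [phi a = b^(k-1)], where [k] is 1 or 3.
    Then [(a, 1)] and [(1, b)] satisfy the relations of the presentation; in the
    presented group [y^2] is central ([rels_sq_comm]), so that
    [(a^i, b^j) |-> x^i y^j] is a homomorphism, and evaluation of words is its
    inverse ([inverting_iso_fixing]). *)

(** * Homomorphisms out of a finite cyclic group *)

Lemma eq_expg_modn {P : groupType} {z : P} {k m n : nat} :
  z ^+ k = 1 -> m = n %[mod k] -> z ^+ m = z ^+ n.
Proof.
move=> zk; suff red i : z ^+ i = z ^+ (i %% k) by move=> e; rewrite red e -red.
by rewrite [in LHS](divn_eq i k) expgnDr mulnC expgnA zk expg1n mul1g.
Qed.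

Lemma generatorX {T : finGroupType} {x : T} (y : T) :
  generator [set: T] x -> exists2 i, i < #[x] & y = x ^+ i.
Proof.
move=> /eqP genx; have /cyclePmin [i lti ->] : y \in <[x]> by rewrite -genx inE.
by exists i.
Qed.

(** The exponent of [y] as a power of [x], and 0 if it is not a power. *)
Definition dlog {T : finGroupType} (x y : T) : nat :=
  if [pick i : 'I_#[x] | x ^+ i == y] is Some i then i else 0.

Lemma expg_dlog {T : finGroupType} {x : T} (y : T) :
  generator [set: T] x -> x ^+ dlog x y = y.
Proof.
move=> /(generatorX y) [i lti ->]; rewrite /dlog.
by case: pickP => [j /eqP //|/(_ (Ordinal lti)) /=]; rewrite eqxx.
Qed.

(** The map sending each power of the generator [x] to the same power of [z];
    it is a homomorphism as soon as the order of [x] kills [z]. *)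
Definition cyc_lift {T : finGroupType} {P : groupType} (x : T) (z : P) (y : T) :=
  z ^+ dlog x y.

Section CycLift.
Context {T : finGroupType} {P : groupType} {x : T} {z : P}.
Hypotheses (genx : generator [set: T] x) (zx : z ^+ #[x] = 1).

Lemma cyc_liftX i : cyc_lift x z (x ^+ i) = z ^+ i.
Proof.
apply: (eq_expg_modn zx); apply/eqP.
by rewrite -eq_expg_mod_order expg_dlog.
Qed.

Lemma cyc_lift1 : cyc_lift x z 1 = 1.
Proof. exact: (cyc_liftX 0). Qed.

Lemma cyc_lift_gen : cyc_lift x z x = z.
Proof. exact: (cyc_liftX 1). Qed.

Lemma cyc_liftM : {morph cyc_lift x z : y1 y2 / y1 * y2}.
Proof.
move=> y1 y2; case: (generatorX y1 genx) => i _ ->.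
by case: (generatorX y2 genx) => j _ ->; rewrite -expgnDr !cyc_liftX expgnDr.
Qed.

End CycLift.

Lemma morph_1 {P Q : groupType} (f : P -> Q) :
  {morph f : x y / x * y} -> f 1 = 1.
Proof. by move=> fM; apply: (mulgI (f 1)); rewrite -fM !mulg1. Qed.

Lemma morph_V {P Q : groupType} (f : P -> Q) :
  {morph f : x y / x * y} -> forall x, f x^-1 = (f x)^-1.
Proof.
by move=> fM x; apply: (mulgI (f x)); rewrite -fM !mulgV morph_1.
Qed.

Lemma morph_expg {P Q : groupType} (f : P -> Q) :
  {morph f : x y / x * y} -> forall x n, f (x ^+ n) = f x ^+ n.
Proof.
move=> fM x; elim=> [|n IH]; last by rewrite !expgS fM IH.
exact: morph_1.
Qed.

(** * Matched pairs *)

Lemma matched_pair_of {H G : finGroupType} (l : G -> H -> H) (r : G -> H -> G) :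
  is_matched_pair l r ->
  exists m : matched_pair H G, mp_lact m =2 l /\ mp_ract m =2 r.
Proof.
move=> lr; pose p := ([ffun x => l x.1 x.2] : {ffun G * H -> H},
                      [ffun x => r x.1 x.2] : {ffun G * H -> G}).
have pP : `[< is_matched_pair (fun g h => p.1 (g, h)) (fun g h => p.2 (g, h)) >].
  by case: lr => *; apply/asboolP; split=> *; rewrite !ffunE /=; auto.
by exists (exist _ p pP); split=> g h; rewrite /mp_lact /mp_ract /= ffunE.
Qed.

Lemma matched_pair_ext {H G : finGroupType} (m m' : matched_pair H G) :
  mp_lact m =2 mp_lact m' -> mp_ract m =2 mp_ract m' -> m = m'.
Proof.
move=> el er; apply: val_inj; case: m m' el er => [[p1 p2] ?] [[q1 q2] ?] /= el er.
by congr pair; apply/ffunP=> -[g h]; [apply: el | apply: er].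
Qed.

Lemma trivial_lact {H G : finGroupType} g h : mp_lact (trivial_mp H G) g h = h.
Proof. by rewrite /mp_lact ffunE. Qed.

Lemma trivial_ract {H G : finGroupType} g h : mp_ract (trivial_mp H G) g h = g.
Proof. by rewrite /mp_ract ffunE. Qed.

Lemma pi_K2_eq {H G : finGroupType} (m m' : matched_pair H G) :
  (\pi_(K2 H G)%qT m = \pi_(K2 H G)%qT m') <-> approx1 m m'.
Proof.
split=> [/eqP|e]; last apply/eqP; rewrite eqmodE; first by move/asboolP.
exact/asboolP.
Qed.

(** Having a trivial right action is an invariant of the equivalence. *)
Lemma approx1_ract_trivial {H G : finGroupType} {m m' : matched_pair H G} :
  approx1 m m' -> (forall g h, mp_ract m g h = g) ->
  forall g h, mp_ract m' g h = g.
Proof.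
by case=> r [v [bv _ e2 _ _]] triv g h; apply: (bij_inj bv); rewrite e2 triv.
Qed.

(** For commutative groups the class of the trivial pair is a singleton. *)
Lemma approx1_trivial {H G : finGroupType} (m : matched_pair H G) :
  abelian [set: H] -> approx1 (trivial_mp H G) m -> m = trivial_mp H G.
Proof.
move=> cHH tm; have tr := approx1_ract_trivial tm trivial_ract.
case: tm => r [v [_ e1 _ _ _]]; apply: matched_pair_ext => g h.
  have := e1 g h; rewrite !trivial_lact tr (centsP cHH (r g) _ h) ?inE //.
  by move/mulIg.
by rewrite tr trivial_ract.
Qed.

(** * Parity in the cyclic group of order six *)

(** The nontrivial homomorphism from C6 to the group of order two, with
    [true] as the nontrivial value. In terms of a generator [b], it is the
    parity of the exponent of [b]; defined through cubes, it does not depend on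
    the choice of [b]. *)
Definition c6odd {G : finGroupType} (g : G) : bool := g ^+ 3 != 1.

Section C6.
Context {G : finGroupType} {b : G}.
Hypotheses (genb : generator [set: G] b) (ob : #[b] = 6%N).

Lemma c6_comm (g1 g2 : G) : commute g1 g2.
Proof.
case: (generatorX g1 genb) => i _ ->; case: (generatorX g2 genb) => j _ ->.
exact: commuteX2.
Qed.

Lemma c6oddX i : c6odd (b ^+ i) = odd i.
Proof.
rewrite /c6odd -expgnA -order_dvdn ob (_ : 6 = 2 * 3)%N //.
by rewrite dvdn_pmul2r // dvdn2 negbK.
Qed.

Lemma c6odd_gen : c6odd b.
Proof. exact: (c6oddX 1). Qed.

Lemma c6oddM (g1 g2 : G) : c6odd (g1 * g2) = c6odd g1 (+) c6odd g2.
Proof.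
case: (generatorX g1 genb) => i _ ->; case: (generatorX g2 genb) => j _ ->.
by rewrite -expgnDr !c6oddX oddD.
Qed.

Lemma c6oddV (g : G) : c6odd g^-1 = c6odd g.
Proof. by rewrite /c6odd expVgn invg_eq1. Qed.

Lemma generator_c6V : generator [set: G] b^-1.
Proof. by move: genb; rewrite /generator cycleV. Qed.

(** Both elements of order three are squares of generators: besides
    [b ^+ 2] itself, [b ^+ 4] is the square of [b^-1]. *)
Lemma c6_cube_eq1 (c : G) : c ^+ 3 = 1 ->
  c = 1 \/ exists2 b', generator [set: G] b' & c = b' ^+ 2.
Proof.
case: (generatorX c genb) => i; rewrite ob => lti -> /eqP.
rewrite -expgnA -order_dvdn ob.
case: i lti => [|[|[|[|[|[|]]]]]] // _ _; [by left | by right; exists b |].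
right; exists b^-1; first exact: generator_c6V.
by apply: (mulgI (b ^+ 2)); rewrite expVgn mulgV -expgnDr
  (_ : 2 + 4 = #[b])%N ?expg_order.
Qed.

(** C6 has exactly two elements of order three, inverse to each other. *)
Lemma c6_order3 (c c' : G) :
  c ^+ 3 = 1 -> c != 1 -> c' ^+ 3 = 1 -> c' != 1 -> c' = c \/ c' = c^-1.
Proof.
case: (generatorX c genb) => i; rewrite ob => lti ->.
case: (generatorX c' genb) => j; rewrite ob => ltj ->.
move=> /eqP; rewrite -!expgnA -!order_dvdn ob => d3i di /eqP.
rewrite -!order_dvdn ob => d3j dj.
have [e|] := eqVneq (b ^+ j) (b ^+ i); first by left.
rewrite eq_expg_mod_order ob => nij; right; apply/eqP.
rewrite eq_mulgV1 invgK -expgnDr -order_dvdn ob.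
(* Only the exponents 2 and 4 survive among those below 6. *)
by move: i j lti ltj d3i di d3j dj nij; do 6?[case=> //]; do 6?[case=> //].
Qed.

End C6.

(** * Matched pairs in which odd elements act by inversion *)

(** The matched pair on H = C3 and G = C6 given by [phi : H -> G]: odd elements
    [g] act on H by inversion and are sent to [g * phi h] by [h], even elements
    act trivially and are fixed. It is a matched pair when [phi] is a homomorphism. *)
Definition inverting_pair {H G : finGroupType} (m : matched_pair H G)
    (phi : H -> G) : Prop :=
  (forall g h, mp_lact m g h = if c6odd g then h^-1 else h) /\
  (forall g h, mp_ract m g h = if c6odd g then g * phi h else g).

Section C3C6.
Context {H G : finGroupType} {a : H} {b : G}.
Hypotheses (gena : generator [set: H] a) (oa : #[a] = 3%N).
Hypotheses (genb : generator [set: G] b) (ob : #[b] = 6%N).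

Lemma c3_comm (h1 h2 : H) : commute h1 h2.
Proof.
case: (generatorX h1 gena) => i _ ->; case: (generatorX h2 gena) => j _ ->.
exact: commuteX2.
Qed.

Lemma c3_cases (h : H) : [\/ h = 1, h = a | h = a^-1].
Proof.
case: (generatorX h gena) => i; rewrite oa => lti ->.
case: i lti => [|[|[|]]] // _; [exact: Or31 | exact: Or32 | apply: Or33].
by apply: (mulgI a); rewrite mulgV -expgS -oa expg_order.
Qed.

Lemma c3_gen_neq1 : a != 1.
Proof. by rewrite -order_eq1 oa. Qed.

Lemma c3_gen_neqV : a^-1 != a.
Proof. by rewrite eq_sym eq_mulgV1 invgK -[a * a]/(a ^+ 2) -order_dvdn oa. Qed.

Lemma c3_cube (h : H) : h ^+ 3 = 1.
Proof.
by case: (generatorX h gena) => i _ ->; rewrite expgnAC -oa expg_order expg1n.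
Qed.

Section Morphism.
Context {phi : H -> G}.
Hypothesis phiM : {morph phi : x y / x * y}.

Lemma morph_c3_cube h : phi h ^+ 3 = 1.
Proof.
by rewrite -(morph_expg phi phiM) c3_cube (morph_1 phi phiM).
Qed.

Lemma morph_c3_even h : c6odd (phi h) = false.
Proof. by rewrite /c6odd morph_c3_cube eqxx. Qed.

Lemma morph_c3_eq (psi : H -> G) :
  {morph psi : x y / x * y} -> phi a = psi a -> phi =1 psi.
Proof.
move=> psiM e h; case: (generatorX h gena) => i _ ->.
by rewrite (morph_expg _ phiM) (morph_expg _ psiM) e.
Qed.

Lemma inverting_pair_exists : exists m : matched_pair H G, inverting_pair m phi.
Proof.
have cG := c6_comm genb; have cH := c3_comm.
have [] // := @matched_pair_of H G
  (fun g h => if c6odd g then h^-1 else h)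
  (fun g h => if c6odd g then g * phi h else g); last first.
  by move=> m [l r]; exists m; split.
have oM := c6oddM genb ob; have o1 : c6odd (1 : G) = false.
  by rewrite /c6odd expg1n eqxx.
have [phi1 phiV] := (morph_1 phi phiM, morph_V phi phiM).
split=> [h|g1 g2 h|g|g h1 h2|g h1 h2|g1 g2 h].
- by rewrite o1.
- by rewrite oM; case: (c6odd g1) (c6odd g2) => -[] //=; rewrite invgK.
- by rewrite phi1 mulg1 if_same.
- case og: (c6odd g); rewrite ?og // oM og morph_c3_even /=.
  by rewrite phiM mulgA.
- case og: (c6odd g); rewrite ?og // oM og morph_c3_even /=.
  by rewrite invMg cH.
- rewrite oM; case: (c6odd g1) (c6odd g2) => -[] //=; rewrite ?mulgA //.
  + by rewrite phiV -(mulgA g1) (cG (phi h)^-1) mulgA mulgKV.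
  + by rewrite -!mulgA (cG g2 (phi h)).
Qed.

End Morphism.

Lemma inverting_pair_eq {m m' : matched_pair H G} {phi psi : H -> G} :
  inverting_pair m phi -> inverting_pair m' psi -> phi =1 psi -> m = m'.
Proof.
move=> [l r] [l' r'] e; apply: matched_pair_ext => g h; first by rewrite l l'.
by rewrite r r' e.
Qed.

(** Inversion of C6 exchanges the pairs given by [phi] and by its inverse. *)
Lemma inverting_pair_approx1V {m m' : matched_pair H G} {phi psi : H -> G} :
  inverting_pair m phi -> inverting_pair m' psi ->
  (forall h, psi h = (phi h)^-1) -> approx1 m m'.
Proof.
move=> [l r] [l' r'] e; have cG := c6_comm genb.
exists (fun=> 1), (fun g => g^-1); split=> [|g h|g h|g1 g2|g1 g2].
- by exists (fun g => g^-1); apply: invgK.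
- by rewrite mulg1 mul1g l l' c6oddV.
- rewrite r r' c6oddV; case: ifP => // _.
  by rewrite e invMg invgK cG.
- by rewrite mp_lactg1 mulg1.
- by rewrite (ract1 (mpP m)) invMg cG.
Qed.

Lemma inverting_pair_approx1 {m m' : matched_pair H G} {phi psi : H -> G} :
  {morph phi : x y / x * y} -> {morph psi : x y / x * y} ->
  inverting_pair m phi -> inverting_pair m' psi ->
  phi a != 1 -> psi a != 1 -> approx1 m m'.
Proof.
move=> phiM psiM im im' nphi npsi.
have [] // := c6_order3 genb ob (phi a) (psi a).
- exact: morph_c3_cube.
- exact: morph_c3_cube.
- move=> e; rewrite (inverting_pair_eq im im' (morph_c3_eq phiM psi psiM _)) //.
  exact: approx1_refl.
- move=> e; apply: (inverting_pair_approx1V im im') => h.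
  apply: (morph_c3_eq psiM (fun h => (phi h)^-1)) => // x y.
  by rewrite phiM invMg (c6_comm genb).
Qed.

(** The right action of a group of exponent three cannot move a generator of a
    cyclic group of order dividing six to another power of it: if [c] goes to
    its [j]-th power, then [j ^ 3 = 1], which forces [j = 1]. *)
Lemma ract_fix (m : matched_pair H G) (h : H) (c : G) :
  #[c] %| 6 -> mp_ract m c h \in <[c]> ->
  (forall i, mp_ract m (c ^+ i) h = mp_ract m c h ^+ i) -> mp_ract m c h = c.
Proof.
move=> oc /cyclePmin [j ltj ej] cX; have M := mpP m.
have : mp_ract m c (h ^+ 3) = c ^+ (j * j * j).
  by rewrite expgS expg2 !(ractM M) ej cX ej -expgnA cX ej -expgnA mulnA.
rewrite c3_cube (ract1 M) ej -[X in X = _]expg1 => /eqP.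
rewrite eq_expg_mod_order => e; rewrite -[RHS]expg1; apply/eqP.
rewrite eq_expg_mod_order; move: oc ltj e.
case: #[c] => [|[|[|[|[|[|[|n]]]]]]] // _;
  by case: j {ej} => [|[|[|[|[|[|]]]]]].
Qed.

Lemma matched_pair_classification (m : matched_pair H G) :
  m = trivial_mp H G \/
  exists phi : H -> G, {morph phi : x y / x * y} /\ inverting_pair m phi.
Proof.
have M := mpP m; pose q g := mp_lact m g a != a.
have cG := c6_comm genb; have cH := c3_comm.
have linj g : injective (mp_lact m g).
  by move=> h1 h2 /(congr1 (mp_lact m g^-1)); rewrite -!(lactM M) mulVg !(lact1 M).
(* The action fixes 1, so it either fixes or exchanges the two other elements. *)
have lE g h : mp_lact m g h = if q g then h^-1 else h.
  have nV := c3_gen_neqV; have n1 := c3_gen_neq1.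
  have la : mp_lact m g a != 1.
    by rewrite -(mp_lactg1 m g) (inj_eq (@linj g)).
  have lV : mp_lact m g a^-1 != 1.
    by rewrite -(mp_lactg1 m g) (inj_eq (@linj g)) invg_eq1.
  have lVa : mp_lact m g a^-1 != mp_lact m g a by rewrite (inj_eq (@linj g)).
  rewrite /q; case: (c3_cases h) => ->; first by rewrite mp_lactg1 invg1 if_same.
    case: (c3_cases (mp_lact m g a)) la => ->; rewrite ?eqxx //.
    by rewrite (negbTE nV).
  case: (c3_cases (mp_lact m g a)) la lVa => ->; rewrite ?eqxx //= => _.
    by case: (c3_cases (mp_lact m g a^-1)) lV => ->; rewrite ?eqxx.
  by case: (c3_cases (mp_lact m g a^-1)) lV => ->; rewrite ?eqxx ?invgK ?nV.
have qM g1 g2 : q (g1 * g2) = q g1 (+) q g2.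
  have nV := c3_gen_neqV; rewrite {1}/q (lactM M) !lE.
  by case: (q g1) (q g2) => -[] /=; rewrite ?invgK ?eqxx ?nV.
have q1 : q 1 = false by rewrite /q (lact1 M) eqxx.
have qX g i : q (g ^+ i) = q g && odd i.
  elim: i => [|i IH]; first by rewrite q1 andbF.
  by rewrite expgS qM IH /=; case: (q g); case: (odd i).
have lM g : {morph mp_lact m g : x y / x * y}.
  by move=> x y; rewrite !lE; case: (q g); rewrite // invMg cH.
have qract g h : q (mp_ract m g h) = q g.
  have := lact_mul M g h a; rewrite lM => /mulgI; rewrite /q => <-.
  by [].
(* On the elements acting trivially on C3 each [h] acts as a homomorphism. *)
have ract_hom g h : q g = false ->
    forall i, mp_ract m (g ^+ i) h = mp_ract m g h ^+ i.
  move=> qg; elim=> [|i IH]; first by rewrite mp_ract1g.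
  by rewrite !expgSr (ract_mul M) lE qg IH.
have [qb|qb] := boolP (q b); last first.
  left; have qF g : q g = false.
    by case: (generatorX g genb) => i _ ->; rewrite qX (negbTE qb).
  apply: matched_pair_ext => g h; first by rewrite lE qF trivial_lact.
  rewrite trivial_ract; case: (generatorX g genb) => i _ ->.
  rewrite ract_hom //; congr (_ ^+ _); apply: ract_fix.
  - by rewrite ob.
  - by case: (generatorX (mp_ract m b h) genb) => j _ ->; apply: mem_cycle.
  - exact: ract_hom.
have qE g : q g = c6odd g.
  by case: (generatorX g genb) => i _ ->; rewrite qX qb (c6oddX ob).
(* An even power of [b] is sent to an even element, so [ract_fix] applies to
   the subgroup generated by [b ^+ 2]. *)
have fixb2 h : mp_ract m (b ^+ 2) h = b ^+ 2.
  have q2 : q (b ^+ 2) = false by rewrite qX andbF.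
  apply: ract_fix; last exact: ract_hom.
  - by rewrite order_dvdn -expgnA -order_dvdn ob.
  - have := qract (b ^+ 2) h; rewrite q2.
    case: (generatorX (mp_ract m (b ^+ 2) h) genb) => j _ ->.
    rewrite qX qb /= => oj; have /negbT oj' := oj.
    by rewrite -(even_halfK oj') -mul2n expgnA mem_cycle.
have fix_even g h : q g = false -> mp_ract m g h = g.
  case: (generatorX g genb) => i _ ->; rewrite qX qb /= => /negbT oi.
  rewrite -(even_halfK oi) -mul2n expgnA ract_hom ?fixb2 //.
  by rewrite qX andbF.
right; exists (fun h => b^-1 * mp_ract m b h).
have rE g h : mp_ract m g h = if c6odd g then g * (b^-1 * mp_ract m b h) else g.
  rewrite -qE; case qg: (q g); last exact: fix_even.
  have qe : q (g * b^-1) = false.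
    by rewrite qM (qE b^-1) c6oddV -qE qb qg.
  by rewrite -{1}(mulgKV b g) (ract_mul M) fix_even // mulgA.
split; last first.
  split=> g h; first by rewrite lE qE.
  exact: rE.
move=> h1 h2; rewrite (ractM M) (rE (mp_ract m b h1)) -qE qract qb.
exact: mulgA.
Qed.

End C3C6.

(** * Isomorphisms onto the three groups *)

Lemma iso_fixing_morph {B P : groupType} (x : B) (y : P) (f : B -> P) :
  {morph f : u v / u * v} -> bijective f -> f x = y -> iso_fixing x y.
Proof.
move=> fM bf fx; pose mf := isMultiplicative.Build B P f fM.
pose F : {multiplicative B -> P} := HB.pack f mf.
by exists F; split=> // n; rewrite -fx; apply: morph_expg.
Qed.

(** The value in a group of a word, given the values of the generators. *)
Definition word_val {T : Type} {Q : groupType} (s : T -> Q) (w : word T) : Q :=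
  foldr (fun l q => (if l.2 then (s l.1)^-1 else s l.1) * q) 1 w.

Lemma word_val_cat {T : Type} {Q : groupType} (s : T -> Q) (u w : word T) :
  word_val s (u ++ w) = word_val s u * word_val s w.
Proof. by elim: u => [|l u IH] /=; rewrite ?mul1g // IH mulgA. Qed.

Lemma word_val_pow {Q : groupType} (s : bool -> Q) (w : word bool) (n : nat) :
  word_val s (wpow w n) = word_val s w ^+ n.
Proof. by elim: n => [//|n IH]; rewrite expgS -IH -word_val_cat. Qed.

Lemma word_val_a {Q : groupType} (s : bool -> Q) : word_val s wa = s true.
Proof. by rewrite /= mulg1. Qed.

Lemma word_val_b {Q : groupType} (s : bool -> Q) : word_val s wb = s false.
Proof. by rewrite /= mulg1. Qed.

Definition word_valE := (@word_val_pow, @word_val_cat, @word_val_a, @word_val_b).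

Lemma word_val_eq {T : Type} {Q : groupType} (s : T -> Q)
    (rels : word T * word T -> Prop) :
  (forall p, rels p -> word_val s p.1 = word_val s p.2) ->
  forall u w, word_eq rels u w -> word_val s u = word_val s w.
Proof.
move=> srel u w; elim=> {u w} //.
- by move=> u w /srel.
- by case=> t [] /=; rewrite mulg1 ?mulVg ?mulgV.
- by move=> u w t _ -> _ ->.
- by move=> u u' w w' _ e1 _ e2; rewrite !word_val_cat e1 e2.
Qed.

Section PresentedGroup.
Context {T : choiceType} {rels : word T * word T -> Prop}.

Lemma word_val_gen (w : word T) :
  word_val (presented_gen rels) w = (\pi_(presented rels) w)%qT.
Proof.
elim: w => [//|[t e] w IH]; rewrite -cat1s word_val_cat IH /= mulg1.
rewrite -(presented_mulE rels [:: (t, e)] w); congr (_ * _).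
by case: e => //; apply: (presented_invE rels [:: (t, false)]).
Qed.

Lemma presented_rel (u w : word T) : rels (u, w) ->
  word_val (presented_gen rels) u = word_val (presented_gen rels) w.
Proof. by move=> r; rewrite !word_val_gen; apply/eqP/presentedP/WordEqRel. Qed.

(** A homomorphism [f] from [Q] to a presented group is bijective as soon as the
    generators have preimages [s t] that satisfy the defining relations and
    generate [Q]: evaluating words at these preimages is then inverse to [f]. *)
Lemma presented_bij {Q : groupType} (s : T -> Q) (f : Q -> presented rels) :
  {morph f : x y / x * y} -> (forall t, f (s t) = presented_gen rels t) ->
  (forall p, rels p -> word_val s p.1 = word_val s p.2) ->
  (forall q, exists w, q = word_val s w) ->
  bijective f.
Proof.
move=> fM fs srel sgen.
have [f1 fV] := (morph_1 f fM, morph_V f fM).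
have fw w : f (word_val s w) = (\pi_(presented rels) w)%qT.
  rewrite -word_val_gen; elim: w => //= -[t e] w IH; rewrite fM IH.
  by case: e; rewrite /= ?fV fs.
exists (fun x => word_val s (repr x)) => [q|x]; last by rewrite fw reprK.
have [w ->] := sgen q; rewrite fw; apply: (word_val_eq s rels srel).
exact: presented_repr.
Qed.

End PresentedGroup.

(** In any group, the relations presenting the two nonabelian groups imply that
    the square of [y] commutes with [x]. *)
Lemma rels_sq_comm {Q : groupType} {x y : Q} {k : nat} : k = 1%N \/ k = 3%N ->
  x ^+ 3 = 1 -> y ^+ 6 = 1 -> y * x = x ^+ 2 * y ^+ k -> commute (y ^+ 2) x.
Proof.
move=> k13 x3 y6 yx; have x2 : x ^+ 2 = x^-1.
  by apply: (mulgI x); rewrite mulgV -expgS.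
case: k13 yx => ->; rewrite x2 => yx; rewrite /commute expg2.
  rewrite expg1 in yx.
  have e : y * x^-1 = x * y by apply: (mulIg x); rewrite mulgKV -mulgA yx mulKVg.
  by rewrite -mulgA yx !mulgA e.
(* With x y x = y ^+ 3 of order two, y x^-1 y = x, so that
   y x = x^-1 y ^+ 3 = y^-1 x y ^+ 2. *)
have e : x * y * x = y ^+ 3 by rewrite -mulgA yx mulKVg.
have e1 : y * x^-1 * y = x.
  have : (x * y * x) * (x * y * x) = 1 by rewrite e -expgnDr.
  rewrite -!mulgA (mulgA x x) -[x * x]/(x ^+ 2) x2 => e2.
  apply: (mulgI x); apply: (mulIg x); rewrite -!mulgA e2.
  by rewrite -x3.
have e3 : x^-1 * y = y^-1 * x by rewrite -{2}e1 -!mulgA mulKg.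
by rewrite -mulgA yx (expgS y 2) (mulgA x^-1) e3 !mulgA mulgV mul1g.
Qed.

(** Throughout, [m] is the pair given by [phi], and the generators [a] of C3
    and [b] of C6 are such that [phi a = b ^+ (k - 1)]. *)
Section InvertingIso.
Context {H G : finGroupType} {a : H} {b : G}.
Hypotheses (gena : generator [set: H] a) (oa : #[a] = 3%N).
Hypotheses (genb : generator [set: G] b) (ob : #[b] = 6%N).
Context {m : matched_pair H G} {phi : H -> G} {k : nat}.
Hypotheses (phiM : {morph phi : x y / x * y}) (im : inverting_pair m phi).
Hypotheses (k13 : k = 1%N \/ k = 3%N) (phia : phi a = b ^+ k.-1).

Let x := presented_gen (rels_C3C6 k) true.
Let y := presented_gen (rels_C3C6 k) false.

Let k_gt0 : 0 < k. Proof. by case: k13 => ->. Qed.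

Lemma P_C3C6_rels : [/\ x ^+ 3 = 1, y ^+ 6 = 1 & y * x = x ^+ 2 * y ^+ k].
Proof.
have rel := @presented_rel _ (rels_C3C6 k).
split.
- by have := rel _ _ (Or31 _ _ erefl); rewrite !word_valE.
- by have := rel _ _ (Or32 _ _ erefl); rewrite !word_valE.
- by have := rel _ _ (Or33 _ _ erefl); rewrite !word_valE.
Qed.

(** The isomorphism sends [(a^i, b^j)] to [x^i y^j]. *)
Let f (u : bicrossed m) : P_C3C6 k := cyc_lift a x u.1 * cyc_lift b y u.2.

Lemma inverting_iso_morph : {morph f : u v / u * v}.
Proof.
have [x3 y6 yx] := P_C3C6_rels; have cyx := rels_sq_comm k13 x3 y6 yx.
have xa : x ^+ #[a] = 1 by rewrite oa.
have yb : y ^+ #[b] = 1 by rewrite ob.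
have [XM YM] := (cyc_liftM gena xa, cyc_liftM genb yb).
have [lE rE] := im.
have even_comm g h : c6odd g = false -> commute (cyc_lift b y g) (cyc_lift a x h).
  case: (generatorX g genb) => i _ ->; rewrite (c6oddX ob) => /negbT oi.
  rewrite cyc_liftX // -(even_halfK oi) -mul2n expgnA.
  by apply/commuteX2.
(* The relation [y x = x^-1 y y^(k-1)] propagates to the powers of [x], since
   [y^(k-1)] is a power of the central element [y^2]. *)
have ya h : y * cyc_lift a x h =
    cyc_lift a x h^-1 * (y * cyc_lift b y (phi h)).
  case: (generatorX h gena) => i _ ->; elim: i => [|i IH].
    by rewrite invg1 (morph_1 phi phiM) !cyc_lift1 // !mulg1 mul1g.
  have xV : cyc_lift a x a^-1 = x ^+ 2.
    rewrite -(cyc_liftX gena xa); congr cyc_lift.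
    by apply: (mulgI a); rewrite mulgV -expgS -oa expg_order.
  have ybk : y * cyc_lift b y (phi a) = y ^+ k.
    by rewrite phia cyc_liftX // -expgS (prednK k_gt0).
  rewrite expgS XM cyc_lift_gen // mulgA yx -ybk.
  rewrite -!mulgA even_comm; last exact: (morph_c3_even gena oa phiM).
  by rewrite (mulgA y) IH (c3_comm gena a) phiM YM invMg XM xV !mulgA.
(* The commutation rule of the bicrossed product holds for the images. *)
have key g h : cyc_lift b y g * cyc_lift a x h =
    cyc_lift a x (mp_lact m g h) * cyc_lift b y (mp_ract m g h).
  rewrite lE rE; case og: (c6odd g); last exact: even_comm.
  have [e -> oe] : exists2 e, g = e * b & c6odd e = false.
    exists (g * b^-1); first by rewrite mulgKV.
    by rewrite (c6oddM genb ob) c6oddV og (c6odd_gen ob).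
  have Yb : cyc_lift b y b = y by exact: cyc_lift_gen.
  rewrite !YM Yb -!mulgA ya (mulgA (cyc_lift b y e) (cyc_lift a x _)).
  by rewrite even_comm // !mulgA.
move=> [h1 g1] [h2 g2]; rewrite /f /= XM YM -!mulgA; congr (_ * _).
by rewrite !mulgA key.
Qed.

Lemma inverting_iso_fixing :
  @iso_fixing (bicrossed m) (P_C3C6 k) (bicrossed_inl m a) (Pa k).
Proof.
have [x3 y6 yx] := P_C3C6_rels; have M := mpP m; have [lE rE] := im.
have xa : x ^+ #[a] = 1 by rewrite oa.
have yb : y ^+ #[b] = 1 by rewrite ob.
pose inr (g : G) : bicrossed m := (1, g).
have inlM : {morph bicrossed_inl m : u v / u * v}.
  by move=> u v; congr pair; rewrite /= ?(lact1 M) // mp_ract1g mulg1.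
have inrM : {morph inr : u v / u * v}.
  by move=> u v; congr pair; rewrite /= ?mp_lactg1 ?mulg1 // (ract1 M).
have inlr h g : bicrossed_inl m h * inr g = (h, g).
  by congr pair; rewrite /= ?mp_lactg1 ?mulg1 // mp_ract1g mul1g.
have fa : f (bicrossed_inl m a) = x.
  by rewrite /f /= cyc_lift_gen // cyc_lift1 // mulg1.
have fb : f (inr b) = y.
  by rewrite /f /= cyc_lift1 // cyc_lift_gen // mul1g.
apply: (iso_fixing_morph _ _ f) => //; first exact: inverting_iso_morph.
pose s t := if t then bicrossed_inl m a else inr b.
apply: (presented_bij s f) => [||p|[h g]].
- exact: inverting_iso_morph.
- by case.
- case=> ->; cbn [fst snd]; rewrite !word_valE /s.
  + by rewrite -(morph_expg _ inlM) -oa expg_order.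
  + by rewrite -(morph_expg _ inrM) -ob expg_order.
  + rewrite -(morph_expg _ inlM) -(morph_expg _ inrM) inlr.
    congr pair; rewrite /= ?lE ?rE (c6odd_gen ob) ?mul1g ?mulg1.
      by apply: (mulgI a); rewrite mulgV -expgS -oa expg_order.
    by rewrite phia -expgS (prednK k_gt0).
- case: (generatorX h gena) => i _ ->; case: (generatorX g genb) => j _ ->.
  exists (wpow wa i ++ wpow wb j); rewrite -inlr !word_valE.
  by rewrite (morph_expg _ inlM) (morph_expg _ inrM).
Qed.

End InvertingIso.

Lemma trivial_iso_fixing {H G : finGroupType} (a : H) :
  @iso_fixing (bicrossed (trivial_mp H G)) (H * G)%type
    (bicrossed_inl (trivial_mp H G) a) (a, 1).
Proof.
apply: (iso_fixing_morph _ _ (id : bicrossed (trivial_mp H G) -> H * G)) => //.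
  by move=> u v; congr pair; rewrite /= ?trivial_lact ?trivial_ract.
by exists id.
Qed.

Lemma card_eq3 {T : finType} {x y z : T} : x <> y -> x <> z -> y <> z ->
  (forall t, [\/ t = x, t = y | t = z]) -> #|T| = 3%N.
Proof.
move=> /eqP xy /eqP xz /eqP yz cover.
have u : uniq [:: x; y; z] by rewrite /= !inE negb_or xy xz yz.
rewrite -[RHS]/(size [:: x; y; z]) -(card_uniqP u); apply: eq_card => t.
by rewrite !inE; case: (cover t) => ->; rewrite eqxx ?orbT.
Qed.

Theorem corollary4p3 (C3 C6 : finGroupType)
    (hC3 : cyclic [set: C3]) (oC3 : #|[set: C3]| = 3%N)
    (hC6 : cyclic [set: C6]) (oC6 : #|[set: C6]| = 6%N)
    (a : C3) (ha : generator [set: C3] a) :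
  #|{: K2 C3 C6}| = 3%N /\
  forall m : matched_pair C3 C6,
    [\/ @iso_fixing (bicrossed m) (C3 * C6)%type (bicrossed_inl m a) (a, 1),
        @iso_fixing (bicrossed m) (P_C3C6 1) (bicrossed_inl m a) (Pa 1) |
        @iso_fixing (bicrossed m) (P_C3C6 3) (bicrossed_inl m a) (Pa 3)].
Proof.
have oa : #[a] = 3%N by rewrite -oC3; move: ha => /eqP ->.
have [b genb] : exists b, generator [set: C6] b.
  by case/cyclicP: hC6 => b e; exists b; rewrite e generator_cycle.
have order_gen b' : generator [set: C6] b' -> #[b'] = 6%N.
  by move=> /eqP e; rewrite -oC6 e.
have ob := order_gen b genb.
split=> [|m]; last first.
  case: (matched_pair_classification ha oa genb ob m) => [->|[phi [phiM im]]].
    exact/Or31/trivial_iso_fixing.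
  case: (c6_cube_eq1 genb ob (phi a)) => [|phia|[b' genb' phia]].
  - exact: (morph_c3_cube ha oa phiM).
  - by apply: Or32; apply: (inverting_iso_fixing ha oa genb ob phiM im); [left|].
  - apply: Or33; have ob' := order_gen b' genb'.
    by apply: (inverting_iso_fixing ha oa genb' ob' phiM im); [right|].
(* Representatives: the trivial pair, [m1] for the trivial homomorphism and
   [m2] for the one sending [a] to [b ^+ 2]. *)
pose phi (c : C6) : C3 -> C6 := cyc_lift a c.
have lift_morph c : c ^+ 3 = 1 -> {morph phi c : u v / u * v}.
  by move=> c3; apply: cyc_liftM; rewrite ?oa.
have lift_a c : c ^+ 3 = 1 -> phi c a = c.
  by move=> c3; rewrite /phi cyc_lift_gen ?oa.
have e1 : (1 : C6) ^+ 3 = 1 by rewrite expg1n.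
have e2 : (b ^+ 2) ^+ 3 = 1 by rewrite -expgnA (_ : 2 * 3 = #[b])%N ?expg_order.
have nb2 : b ^+ 2 != 1 by rewrite -order_dvdn ob.
have [m1 im1] := inverting_pair_exists ha oa genb ob (lift_morph _ e1).
have [m2 im2] := inverting_pair_exists ha oa genb ob (lift_morph _ e2).
have H3 : abelian [set: C3] by rewrite cyclic_abelian.
have oddb := c6odd_gen ob.
have ract1 g h : mp_ract m1 g h = g.
  case: im1 => _ ->; case: ifP => // _.
  by rewrite /phi /cyc_lift expg1n mulg1.
have nt1 : ~ approx1 (trivial_mp C3 C6) m1.
  move=> /(approx1_trivial _ H3) e; have := c3_gen_neqV oa.
  by have := im1.1 b a; rewrite e trivial_lact oddb => <-; rewrite eqxx.
have ract2 : ~ (forall g h, mp_ract m2 g h = g).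
  move=> /(_ b a); rewrite im2.2 oddb lift_a // -[X in _ = X]mulg1 => /mulgI e.
  by rewrite e eqxx in nb2.
apply: (@card_eq3 _ (\pi_(K2 C3 C6)%qT (trivial_mp C3 C6))
  (\pi_(K2 C3 C6)%qT m1) (\pi_(K2 C3 C6)%qT m2)) => [/pi_K2_eq//||| z].
- by move=> /pi_K2_eq/approx1_ract_trivial/(_ trivial_ract).
- by move=> /pi_K2_eq/approx1_ract_trivial/(_ ract1).
elim/quotW: z => m.
case: (matched_pair_classification ha oa genb ob m) => [->|[psi [psiM im]]].
  exact: Or31.
have [psia|npsi] := eqVneq (psi a) 1.
  apply: Or32; congr (\pi _)%qT; apply: (inverting_pair_eq im im1).
  by apply: (morph_c3_eq ha psiM); [apply: lift_morph | rewrite lift_a].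
apply/Or33/pi_K2_eq.
apply: (inverting_pair_approx1 ha oa genb ob psiM _ im im2) => //.
  exact: lift_morph.
by rewrite lift_a.
Qed.
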